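(* Let $K=L=\{0,1\}$, $R=Q=0$ (so that $X_t=X_0$ and $Y_t=Y_0$ for all $t\ge0$), and let the payoff functions be given, for $(p,q)\in[0,1]^2$, by $$h(p,q)=3p+2q-4,\qquad f(p,q)=2p+3q-1.$$ Then the value of the stopping game is, for $(p,q)\in[0,1]^2$, $$V(p,q)=\begin{cases}0&\text{if }(p,q)\in[\tfrac12,1]\times[0,\tfrac12],\\[2pt] \dfrac{2q-1}{q}(p+q-1)&\text{if }p\ge1-q\text{ and }q\ge\tfrac12,\\[6pt] \dfrac{1-2p}{1-p}(p+q-1)&\text{if }q\le1-p\text{ and }p\le\tfrac12.\end{cases}$$
   Context: **The game.** $X$ and $Y$ are independent continuous-time Markov chains with finite state spaces $K$, $L$, initial laws in $\Delta(K)$, $\Delta(L)$ (unit simplices) and generators $R$, $Q$, realized as canonical processes on $\Omega=\mathbb D([0,\infty),K)\times\mathbb D([0,\infty),L)$ under the product law $\mathbb P_{p,q}$. $\mathcal F^X,\mathcal F^Y$ are the filtrations generated by $X$, $Y$. A mixed $\mathcal F^X$-stopping time is an $\mathcal F^X_\infty\otimes\mathcal B([0,1])$-measurable map $\mu(\omega,u)$ on $\Omega\times[0,1]$ such that $\mu(\cdot,u)$ is an ($[0,+\infty]$-valued) $\mathcal F^X$-stopping time for every $u\in[0,1]$; their set is $\mathcal T^X_m$; $\mathcal T^Y_m$ is defined similarly from $\mathcal F^Y$. $r>0$ is a fixed discount rate, $f\ge h$ are real functions on $K\times L$. Put $$J(\mu,\nu)(\omega,u,v)=e^{-r\nu}f(X_\nu,Y_\nu)\mathbf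 1_{\nu<\mu}+e^{-r\mu}h(X_\mu,Y_\mu)\mathbf 1_{\mu\le\nu}$$ (with $\mu=\mu(\omega,u)$, $\nu=\nu(\omega,v)$, and $J=0$ on $\{\mu=\nu=+\infty\}$) and $\bar J(\mu,\nu)=\int_0^1\int_0^1J\,du\,dv$. The value is $$V(p,q)=\inf_{\nu\in\mathcal T^Y_m}\sup_{\mu\in\mathcal T^X_m}\mathbb E_{p,q}[\bar J(\mu,\nu)]=\sup_{\mu\in\mathcal T^X_m}\inf_{\nu\in\mathcal T^Y_m}\mathbb E_{p,q}[\bar J(\mu,\nu)]$$ (the game always has a value). **Notation for this example.** $f,h$ are extended bilinearly to $\Delta(K)\times\Delta(L)$, and for $(p,q)\in[0,1]^2$ one writes $V(p,q)$, $f(p,q)$, $h(p,q)$ for $V((p,1-p),(q,1-q))$, etc., where $p$ is the probability that $X_0=0$ and $q$ the probability that $Y_0=0$. Thus e.g. the payoff $h$ at state $X=0,Y=0$ is $h(1,1)=1$. *)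

(* Defs.v *)
From HB Require Import structures.
From mathcomp Require Import all_boot all_order all_algebra.
From mathcomp Require Import interval_inference.
From mathcomp Require Import all_classical all_reals all_analysis.
From mathcomp Require Import measurable_realfun.
Set Implicit Arguments.
Unset Strict Implicit.
Unset Printing Implicit Defensive.
Import Order.TTheory GRing.Theory Num.Theory.
Import numFieldNormedType.Exports.

Local Open Scope classical_set_scope.
Local Open Scope ring_scope.

(** ** Càdlàg paths in a finite state space

  The state space with n+1 points is ['I_n.+1], time is [{nonneg R}]. For a
  discrete state space, right-continuity and existence of left limits mean that
  a path is constant on some [[t, t + e[] and on some []t - e, t[]. *)

Definition is_cadlag (R : realType) (n : nat) (w : {nonneg R} -> 'I_n.+1) :=
  forall t : {nonneg R},
    (exists2 e : R, 0 < e &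
       forall s : {nonneg R}, t%:num <= s%:num < t%:num + e -> w s = w t) /\
    (exists2 e : R, 0 < e &
       exists k, forall s : {nonneg R}, t%:num - e < s%:num < t%:num -> w s = k).

Definition cadlag (R : realType) (n : nat) :=
  {w : {nonneg R} -> 'I_n.+1 | is_cadlag w}.

Section cadlag_pointed.
Context (R : realType) (n : nat).

Lemma is_cadlag_cst (k : 'I_n.+1) : is_cadlag (fun=> k : 'I_n.+1) (R := R).
Proof. by move=> t; split; exists 1 => //; exists k. Qed.

HB.instance Definition _ := gen_eqMixin (cadlag R n).
HB.instance Definition _ := gen_choiceMixin (cadlag R n).
HB.instance Definition _ :=
  isPointed.Build (cadlag R n) (exist _ _ (is_cadlag_cst ord0)).
End cadlag_pointed.

Definition coordinate (R : realType) (n : nat) (t : {nonneg R})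
  (w : cadlag R n) : 'I_n.+1 := sval w t.

(* The events {Z_s in B}, s in I; [<<s history Z I >>] is sigma(Z_s, s in I). *)
Definition history (R : realType) (T : Type) (n : nat)
    (Z : {nonneg R} -> T -> 'I_n.+1) (I : set {nonneg R}) : set (set T) :=
  [set A | exists2 s, I s & exists B : set 'I_n.+1, A = Z s @^-1` B].

Definition path_space (R : realType) (n : nat) :=
  g_sigma_algebraType (history (@coordinate R n) setT).

(** ** Laws of continuous-time Markov chains *)

Definition expmx (R : realType) (n : nat) (A : 'M[R]_n.+1) : 'M[R]_n.+1 :=
  \matrix_(i, j) limn (series (fun k => (A ^+ k) i j / k`!%:R)).

(* [P] is the law on path space of the chain with initial law [p] and generator
   [G], given by its finite-dimensional distributions. *)
Definition markov_law (R : realType) (n : nat) (p : 'rV[R]_n.+1)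
    (G : 'M[R]_n.+1) (P : probability (path_space R n) R) :=
  forall (k : nat) (t : nat -> {nonneg R}) (x : nat -> 'I_n.+1),
    (t 0%N)%:num = 0 ->
    (forall i, (i < k)%N -> (t i)%:num <= (t i.+1)%:num) ->
    P [set w | forall i, (i <= k)%N -> coordinate (t i) w = x i] =
    (p ord0 (x 0%N) *
     \prod_(i < k)
       expmx (((t i.+1)%:num - (t i)%:num) *: G) (x i) (x i.+1))%:E.

(** ** Mixed stopping times *)

Definition stopping_time (R : realType) (T : Type) (n : nat)
    (Z : {nonneg R} -> T -> 'I_n.+1) (tau : T -> \bar R) :=
  (forall w, (0 <= tau w)%E) /\
  forall t : {nonneg R},
    <<s history Z [set s | s%:num <= t%:num] >> [set w | (tau w <= t%:num%:E)%E].

(* The randomization device takes values in [0,1]; values of [mu w u] for [u]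
   outside of [0,1] are unconstrained and unused. *)
Definition mixed_stopping_time (R : realType) (T : pointedType) (n : nat)
    (Z : {nonneg R} -> T -> 'I_n.+1) : set (T -> R -> \bar R) :=
  [set mu : T -> R -> \bar R |
     measurable_fun ([set: g_sigma_algebraType (history Z setT)] `*`
                       [set` `[0%R, 1%R : R]])
       (fun z : g_sigma_algebraType (history Z setT) * R => mu z.1 z.2) /\
     forall u : R, 0 <= u <= 1 -> stopping_time Z (mu ^~ u)].

(** ** The stopping game *)

Section game.
Context (R : realType) (m n : nat).

Definition Omega := (path_space R m * path_space R n)%type.

Definition X (t : {nonneg R}) (w : Omega) : 'I_m.+1 := coordinate t w.1.
Definition Y (t : {nonneg R}) (w : Omega) : 'I_n.+1 := coordinate t w.2.

(* Only used for 0 <= tau < +oo, where it is tau itself. *)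
Definition finite_time (tau : \bar R) : {nonneg R} := `|fine tau|%:nng.

Definition discounted (r : R) (g : 'I_m.+1 -> 'I_n.+1 -> R) (w : Omega)
    (tau : \bar R) : R :=
  let t := finite_time tau in expR (- r * t%:num) * g (X t w) (Y t w).

Definition J (r : R) (f h : 'I_m.+1 -> 'I_n.+1 -> R)
    (mu nu : Omega -> R -> \bar R) (w : Omega) (u v : R) : R :=
  if (nu w v < mu w u)%E then discounted r f w (nu w v)
  else if (mu w u < +oo)%E then discounted r h w (mu w u)
  else 0.

(* Extended-real valued only for convenience: [J] is bounded. *)
Definition Jbar (r : R) (f h : 'I_m.+1 -> 'I_n.+1 -> R)
    (mu nu : Omega -> R -> \bar R) (w : Omega) : \bar R :=
  (\int[lebesgue_measure]_(v in `[0%R, 1%R])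
     \int[lebesgue_measure]_(u in `[0%R, 1%R]) (J r f h mu nu w u v)%:E)%E.

Definition expected_payoff (r : R) (f h : 'I_m.+1 -> 'I_n.+1 -> R)
    (PX : probability (path_space R m) R) (PY : probability (path_space R n) R)
    (mu nu : Omega -> R -> \bar R) : \bar R :=
  (\int[PX \x PY]_w Jbar r f h mu nu w)%E.

Definition is_game_value (r : R) (f h : 'I_m.+1 -> 'I_n.+1 -> R)
    (PX : probability (path_space R m) R) (PY : probability (path_space R n) R)
    (V : R) :=
  ereal_inf [set ereal_sup [set expected_payoff r f h PX PY mu nu
                           | mu in mixed_stopping_time X]
            | nu in mixed_stopping_time Y] = V%:E /\
  ereal_sup [set ereal_inf [set expected_payoff r f h PX PY mu nu
                           | nu in mixed_stopping_time Y]
            | mu in mixed_stopping_time X] = V%:E.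

Definition bilinear_ext (g : 'I_m.+1 -> 'I_n.+1 -> R) (p : 'rV[R]_m.+1)
    (q : 'rV[R]_n.+1) : R :=
  \sum_i \sum_j p ord0 i * q ord0 j * g i j.

End game.

(* The law (p, 1 - p) on {0, 1}. *)
Definition law2 (R : realType) (p : R) : 'rV[R]_2 :=
  \row_(i < 2) (if i == ord0 then p else 1 - p).

(** ** The chain with zero generator exists *)

Section zero_generator.
Context (R : realType).

Lemma expmx0 (n : nat) : expmx (0 : 'M[R]_n.+1) = 1%:M.
Proof.
apply/matrixP => i j; rewrite mxE; apply/cvg_lim => //.
apply/cvg_ballP => e e0; exists 1%N => // -[//|N] _.
suff -> : series (fun k => ((0 : 'M[R]_n.+1) ^+ k) i j / k`!%:R) N.+1 =
          (1%:M : 'M[R]_n.+1) i j by exact: ballxx.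
rewrite /series /= big_nat_recl// expr0 fact0 divr1 big1 ?addr0// => k _.
by rewrite exprS mul0r mxE mul0r.
Qed.

Definition cst_path (b : bool) : path_space R 1 :=
  exist _ _ (is_cadlag_cst (if b then ord0 else ord_max)).

Lemma measurable_cst_path : measurable_fun setT cst_path.
Proof. by []. Qed.

HB.instance Definition _ :=
  isMeasurableFun.Build _ _ bool (path_space R 1) cst_path measurable_cst_path.

Lemma markov_law0_exists (p : R) : 0 <= p <= 1 ->
  exists P : probability (path_space R 1) R, markov_law (law2 p) 0 P.
Proof.
move=> p01; exists (distribution (bernoulli_prob p) cst_path).
move=> k t x t0 tS; rewrite [LHS](bernoulli_probE p01).
under eq_bigr do rewrite scaler0 expmx0 mxE.
have E (b : bool) (k0 := if b then ord0 else ord_max : 'I_2) :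
    \d_b (cst_path @^-1`
      [set w | forall i, (i <= k)%N -> coordinate (t i) w = x i])
    = ((x 0%N == k0)%:R * \prod_(i < k) (x i == x i.+1)%:R : R)%:E.
  rewrite diracE; congr (_%:E).
  have [/set_mem/= H|/negP H] := boolP (_ \in _).
    rewrite -(H 0%N)// eqxx mul1r big1// => i _.
    by rewrite -(H i) ?(ltnW (ltn_ord i))// -(H i.+1)// eqxx.
  apply/esym/eqP; rewrite mulf_eq0 pnatr_eq0 eqb0 -implyNb; apply/implyP.
  rewrite negbK => /eqP x0; apply/eqP; apply: contrapT => /eqP nz; apply: H.
  apply/mem_set => /=; elim=> [|i IH] ik; first exact/esym.
  rewrite [LHS](IH (ltnW ik)); apply/eqP.
  move/prodf_neq0: nz => /(_ (Ordinal ik) isT).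
  by rewrite pnatr_eq0 eqb0 negbK.
rewrite !E -!EFinM -EFinD mulrA [in RHS]mxE !mulrA -mulrDl; congr (_ * _)%:E.
case: (x 0%N) => -[|[|//]] i01; rewrite -!val_eqE /=;
  by rewrite ?mulr1 ?mulr0 ?addr0 ?add0r.
Qed.

End zero_generator.

(* Main.v *)
(* Since the chains are constant, a mixed stopping time of X (resp. Y) amounts to a
   distribution of times for each of the two types X_0 = 0, 1 (resp. Y_0 = 0, 1).
   On [1/2, 1] x [0, 1/2] both players never stop. On p + q = 1, q >= 1/2, there is
   a war of attrition in which only the types X = 0 and Y = 1 stop, with survival
   functions of the form S(t) = a - (a - 1) e^{rt/2}: solving
   S' = -(r/2) (a - S) makes the type X = 0 indifferent between all stopping
   times, and symmetrically for Y = 1. Elsewhere one of the players first stops at time 0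
   with the probability alpha which moves the belief on him to the line p + q = 1.
   The strategies do not depend on the opponent's play, so each of them provides
   one of the two bounds on the value. *)

Require Import Defs.
From mathcomp Require Import all_boot all_order all_algebra.
From mathcomp Require Import interval_inference.
From mathcomp Require Import all_classical all_reals all_analysis.
From mathcomp Require Import measurable_realfun.
From mathcomp Require Import ring lra.
Import Order.TTheory GRing.Theory Num.Theory.
Import numFieldNormedType.Exports.
Local Open Scope classical_set_scope.
Local Open Scope ring_scope.

Set Implicit Arguments.
Unset Strict Implicit.
Unset Printing Implicit Defensive.

(** * Integrals against finitely supported measures *)

(** Monotonicity is read off the definition of the integral, a difference of suprema over simple
    functions below the positive and the negative part. In this form it applies to [Jbar], whose
    measurability on all of [Omega] is not at hand. *)
Lemma integral_monotone d (T : measurableType d) (R : realType)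
    (m : {measure set T -> \bar R}) (f g : T -> \bar R) :
  (forall x, (f x <= g x)%E) -> (\int[m]_x f x <= \int[m]_x g x)%E.
Proof.
move=> fg; rewrite /integral !patch_setT; apply: leeB; apply: ereal_sup_le;
  apply: image_subset => k /= kf x; apply: (le_trans (kf x)).
- by apply: (@funepos_le _ _ setT); rewrite ?inE.
- by apply: (@funeneg_le _ _ setT); rewrite ?inE.
Qed.

(* No measurability of [f] is assumed: [f] is squeezed between the functions that
   agree with it on the support and are -oo, resp. +oo, elsewhere. *)
Lemma integral_finite_support d (T : measurableType d) (R : realType)
    (m : {measure set T -> \bar R}) (I : finType) (x : I -> T) (w : I -> R)
    (f : T -> \bar R) (g : I -> R) :
  injective x -> (forall i, measurable [set x i]) ->
  (forall i, m [set x i] = (w i)%:E) -> m.-negligible (~` range x) ->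
  (forall i, f (x i) = (g i)%:E) ->
  (\int[m]_t f t = (\sum_i w i * g i)%:E)%E.
Proof.
move=> xinj mx mw mN fg.
pose G t := (\sum_i (g i)%:E * (\1_[set x i] t)%:E)%E.
have Gx i : G (x i) = (g i)%:E.
  rewrite /G (bigD1 i)//= big1 ?adde0.
    by rewrite indicE mem_set// mule1.
  move=> j ji; rewrite indicE memNset ?mule0//= => /xinj ij.
  by rewrite ij eqxx in ji.
have int1 i : m.-integrable setT (fun t => (\1_[set x i] t)%:E).
  apply/integrableP; split; first exact/measurable_EFinP/measurable_indic.
  under eq_integral do rewrite gee0_abs ?lee_fin//.
  by rewrite integral_indic// setIT (mw i) ltry.
have intG i : m.-integrable setT (fun t => (g i)%:E * (\1_[set x i] t)%:E)%E.
  apply: integrableZl => //; exact: int1.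
have mG : measurable_fun setT G.
  by apply: emeasurable_sum => i; exact: measurable_int (intG i).
have mR : measurable (range x).
  rewrite (_ : range x = \bigcup_(i in setT) [set x i]).
    by apply: fin_bigcup_measurable => //; exact: finite_finset.
  by apply/seteqP; split => [_ [i _ <-]|_ [i _ ->]]; exists i.
have iG : (\int[m]_t G t = (\sum_i w i * g i)%:E)%E.
  rewrite integral_sum// -sumEFin; apply: eq_bigr => i _.
  rewrite integralZl//.
  by rewrite integral_indic// setIT (mw i) -EFinM mulrC.
(* Changing the value off the support to any [c] modifies [G] on a negligible set only; [c] is then
   taken to be +oo and -oo. *)
have key c : (\int[m]_t (if t \in range x then G t else c) =
    \int[m]_t G t)%E.
  have mh : measurable_fun setT (fun t => if t \in range x then G t else c).
    apply: measurable_fun_ifT => //.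
    apply: (measurable_fun_bool true).
    rewrite setTI [X in measurable X](_ : _ = range x)//.
    by apply/seteqP; split => t; [exact: set_mem|exact: mem_set].
  apply: ae_eq_integral => //; apply: (negligibleS _ mN) => t /= /not_implyP[_].
  by case: ifPn => // + _; rewrite notin_setE.
apply/eqP; rewrite eq_le -iG; apply/andP; split.
- rewrite -(key +oo%E); apply: integral_monotone => t.
  by case: ifPn => [/set_mem[i _ <-]|]; rewrite ?leey// Gx fg.
- rewrite -(key -oo%E); apply: integral_monotone => t.
  by case: ifPn => [/set_mem[i _ <-]|]; rewrite ?leNye// Gx fg.
Qed.

(** * Paths of the chain with zero generator *)

(** The absolute value lets all of [rat] index a countable dense set of times. *)
Definition rat_time (R : realType) (a : rat) : {nonneg R} := `|ratr a|%:nng.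

Definition constant_path {R : realType} {n : nat} (k : 'I_n.+1) :
    path_space R n :=
  exist _ _ (is_cadlag_cst k).

Lemma constant_path_inj {R : realType} {n : nat} :
  injective (@constant_path R n).
Proof. by move=> i j /(congr1 (coordinate 0%:nng)). Qed.

(** By right-continuity, the value at [t] is also taken at some rational time just after [t].
    Countably many coordinates thus decide whether a path is constant. *)
Lemma eq_constant_path (R : realType) (n : nat) (k : 'I_n.+1)
    (w : path_space R n) :
  (forall a : rat, coordinate (rat_time R a) w = k) -> w = constant_path k.
Proof.
case: w => w wcadlag wk; apply: eq_exist; apply/funext => t.
have [[e e0 we] _] := wcadlag t.
have [a] : exists a : rat, ratr a \in `]t%:num, (t%:num + e)[.
  by apply: rat_in_itvoo; rewrite ltrDl.
rewrite in_itv/= => /andP[ta ate]; rewrite -[RHS](wk a); symmetry; apply: we.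
by rewrite /= ger0_norm ?(ltW ta)// (le_trans _ (ltW ta)).
Qed.

Lemma measurable_coordinate (R : realType) (n : nat) (t : {nonneg R})
    (k : 'I_n.+1) :
  measurable [set w : path_space R n | coordinate t w = k].
Proof. by apply: sub_sigma_algebra; exists t => //; exists [set k]. Qed.

Lemma measurable_constant_path (R : realType) (n : nat) (k : 'I_n.+1) :
  measurable [set constant_path k : path_space R n].
Proof.
rewrite -[X in measurable X]setCK; apply: measurableC.
rewrite [X in measurable X](_ : _ = \bigcup_(a : rat)
    ~` [set w : path_space R n | coordinate (rat_time R a) w = k]).
  by apply: bigcupT_measurable_rat => a; apply: measurableC;
    exact: measurable_coordinate.
apply/seteqP; split => w /=; last by move=> [a _ /= wk] wE; apply: wk; rewrite wE.
move=> wk; apply: contrapT => wa; apply: wk; apply: eq_constant_path => a.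
by apply: contrapT => wak; apply: wa; exists a.
Qed.

Section zero_generator_law.
Context {R : realType} {n : nat} (p : 'rV[R]_n.+1).
Context (P : probability (path_space R n) R) (hP : markov_law p 0 P).

Let time0 : {nonneg R} := 0%:nng.

Let start k := [set w : path_space R n | coordinate time0 w = k].

Let P_start k : P (start k) = (p ord0 k)%:E.
Proof.
have := @hP 0%N (fun=> time0) (fun=> k); rewrite big_ord0 mulr1 => <- //.
by congr (P _); apply/seteqP; split => w /= => [wk i _|/(_ 0%N)]; [|exact].
Qed.

(** The transition matrices of the zero generator are the identity, so being in [k] at both times 0
    and [t] is as likely as starting in [k]. *)
Let negligible_jump k t :
  P.-negligible (start k `\` [set w | coordinate t w = k]).
Proof.
have mS := measurable_coordinate time0 k : measurable (start k).
have mt := measurable_coordinate t k.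
apply/negligibleP; first exact: measurableD.
rewrite measureD//; last first.
  by apply: le_lt_trans (probability_le1 P mS) _; rewrite ltry.
suff E : P (start k `&` [set w | coordinate t w = k]) = (p ord0 k)%:E.
  apply: (@eq_trans _ _ ((p ord0 k)%:E - (p ord0 k)%:E)%E); last exact: subee.
  by congr (_ - _)%E; [exact: P_start|exact: E].
have := @hP 1%N (fun i => if i is 0%N then time0 else t) (fun=> k).
rewrite big_ord1 /= scaler0 expmx0 mxE eqxx mulr1 => <- //; last first.
  by case => // _; rewrite -[leLHS]/0.
congr (P _); apply/seteqP; split => w /=; first by move=> [w0 wt] [|[|]].
by move=> wk; split; [exact: (wk 0%N)|exact: (wk 1%N)].
Qed.

(** A path that starts in [k] and is not constant differs from [k] at some rational time, so
    countably many null events cover all such paths. *)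
Let negligible_leave k : P.-negligible (start k `\ constant_path k).
Proof.
pose F i := if @unpickle rat i is Some a then
  start k `\` [set w | coordinate (rat_time R a) w = k] else set0.
apply: (@negligibleS _ _ _ _ (\bigcup_i F i)).
  move=> w [wk wc]; apply: contrapT => wF; apply: wc.
  apply: eq_constant_path => a; apply: contrapT => wa; apply: wF.
  by exists (pickle a); [exact: I|rewrite /F pickleK].
apply: negligible_bigcup => i; rewrite /F; case: unpickle => [a|].
  exact: negligible_jump.
exact: negligible_set0.
Qed.

Lemma zero_generator_law1 k : P [set constant_path k] = (p ord0 k)%:E.
Proof.
have mk := measurable_constant_path (R := R) k.
have mS := measurable_coordinate time0 k : measurable (start k).
rewrite -P_start -[in RHS](@setDUK _ [set constant_path k] (start k)).
  rewrite measureU//; [|exact: measurableD|by rewrite setDIK].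
  rewrite [X in (_ + X)%E](_ : _ = 0%E) ?adde0//.
  by apply: measure_negligible (negligible_leave k); exact: measurableD.
by move=> _ ->.
Qed.

Lemma zero_generator_lawC : P.-negligible (~` range constant_path).
Proof.
apply: (@negligibleS _ _ _ _ (\big[setU/set0]_(k : 'I_n.+1)
    (start k `\ constant_path k))).
  move=> w wc; rewrite (bigD1 (coordinate time0 w))//=; left.
  split => //= wk; apply: wc.
  by exists (coordinate time0 w).
by elim/big_ind: _ => [|A B|k _]; [exact: negligible_set0|exact: negligibleU|].
Qed.

End zero_generator_law.

(** The product law is carried by the finitely many pairs of constant paths, the pair (i, j) having
    mass p_i q_j. *)
Lemma expected_payoff_constant (R : realType) (m n : nat) (r : R)
    (f h : 'I_m.+1 -> 'I_n.+1 -> R) (p : 'rV[R]_m.+1) (q : 'rV[R]_n.+1)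
    (PX : probability (path_space R m) R) (PY : probability (path_space R n) R)
    (mu nu : Omega R m n -> R -> \bar R) (g : 'I_m.+1 -> 'I_n.+1 -> R) :
  markov_law p 0 PX -> markov_law q 0 PY ->
  (forall i j,
     Jbar r f h mu nu (constant_path i, constant_path j) = (g i j)%:E) ->
  expected_payoff r f h PX PY mu nu = (bilinear_ext g p q)%:E.
Proof.
move=> hPX hPY Jg; rewrite /bilinear_ext pair_big/=.
pose x (ij : 'I_m.+1 * 'I_n.+1) : Omega R m n :=
  (constant_path ij.1, constant_path ij.2).
have xE ij : [set x ij] = [set constant_path ij.1] `*` [set constant_path ij.2].
  by apply/seteqP; split => [w ->//|[w1 w2] [/= -> ->]].
apply: (@integral_finite_support _ _ _ _ _ x
  (fun ij => p ord0 ij.1 * q ord0 ij.2) _ (fun ij => g ij.1 ij.2)).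
- move=> [i j] [i' j'] e.
  have /= -> := constant_path_inj (congr1 fst e).
  by have /= -> := constant_path_inj (congr1 snd e).
- by move=> ij; rewrite xE; apply: measurableX; exact: measurable_constant_path.
- move=> ij; rewrite xE; apply: eq_trans.
    by apply: product_measure1E; exact: measurable_constant_path.
  by rewrite EFinM -(zero_generator_law1 hPX) -(zero_generator_law1 hPY).
- have [NX [mNX NX0 sX]] := zero_generator_lawC hPX.
  have [NY [mNY NY0 sY]] := zero_generator_lawC hPY.
  apply: (@negligibleS _ _ _ _ ((NX `*` setT) `|` (setT `*` NY))).
    move=> [w1 w2] xw; apply: contrapT => /not_orP[nX nY]; apply: xw.
    have [i _ iw] : range constant_path w1.
      by apply: contrapT => /sX ?; apply: nX.
    have [j _ jw] : range constant_path w2.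
      by apply: contrapT => /sY ?; apply: nY.
    by exists (i, j) => //; rewrite /x iw jw.
  apply: negligibleU; apply/negligibleP; do ?exact: measurableX.
    apply: eq_trans; first by apply: product_measure1E; [exact: mNX|].
    by rewrite [X in (X * _)%E](NX0 : _ = _) mul0e.
  apply: eq_trans; first by apply: product_measure1E; [|exact: mNY].
  by rewrite [X in (_ * X)%E](NY0 : _ = _) mule0.
- by move=> [i j]; exact: Jg.
Qed.

(** * Stopping times as functions of the path *)

Section stopping_times.
Context {R : realType} {T : pointedType} {n : nat}.
Context (Z : {nonneg R} -> T -> 'I_n.+1).

(** The events that contain both or neither of [w] and [w'] form a sigma-algebra containing the
    history of [Z], so no event [tau <= t] separates the two. On constant paths, a player's time
    therefore ignores the type of the opponent. *)
Lemma stopping_time_adapted (tau : T -> \bar R) (w w' : T) :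
  stopping_time Z tau -> (forall t, Z t w = Z t w') -> tau w = tau w'.
Proof.
move=> [tau0 taum] ww'.
have sat I (A : set T) : <<s history Z I >> A -> (A w <-> A w').
  apply: (@smallest_sub _ _ _ [set A : set T | A w <-> A w']) => [|B [t _ [C ->]]].
    split => //=.
    - by move=> B BE; split => -[_ nB]; split => // /BE.
    - by move=> F FE; split => -[i _ Fi]; exists i => //; apply/FE.
  by rewrite /= /preimage/= ww'.
have le (t : {nonneg R}) : (tau w <= t%:num%:E)%E <-> (tau w' <= t%:num%:E)%E.
  exact: sat (taum t).
(* A finite [tau v'] serves as its own threshold [t]; an infinite one bounds everything. *)
have cmp v v' : (forall t : {nonneg R},
    (tau v' <= t%:num%:E)%E -> (tau v <= t%:num%:E)%E) -> (tau v <= tau v')%E.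
  move=> vv'; have := tau0 v'; case E : (tau v') => [s| |]//; rewrite ?leey//.
  by rewrite lee_fin => s0; apply: (vv' (NngNum s0)); rewrite E.
by apply/eqP; rewrite eq_le !cmp// => t /le.
Qed.

Lemma mixed_stopping_time_section (mu : T -> R -> \bar R) (w : T) :
  mixed_stopping_time Z mu -> measurable_fun (`[0, 1]%classic : set R) (mu w).
Proof.
move=> [mmu _].
have m01 : measurable (`[0, 1]%classic : set R) by exact: measurable_itv.
have mw : measurable_fun (`[0, 1]%classic : set R)
    (pair (w : g_sigma_algebraType (history Z setT))).
  by apply: measurable_funTS; exact: pair1_measurable.
apply: measurable_comp mmu mw; first by apply: measurableX.
by move=> _ [u u01 <-].
Qed.

(** All strategies used below have this shape. The event of stopping by time [s] is either empty or
    the event of starting in [k], which is known at time 0. *)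
Lemma mixed_stopping_time_start (k : 'I_n.+1) (t : R -> \bar R) :
  measurable_fun setT t -> (forall u, (0 <= t u)%E) ->
  mixed_stopping_time Z (fun w u => if Z 0%:nng w == k then t u else +oo%E).
Proof.
move=> mt t0.
have hk (I : set {nonneg R}) : I 0%:nng -> <<s history Z I >> [set w | Z 0%:nng w = k].
  by move=> I0; apply: sub_sigma_algebra; exists 0%:nng => //; exists [set k].
split.
  apply: measurable_funTS; apply: measurable_fun_ifT => //=; last first.
    exact: measurableT_comp mt _.
  apply: (measurable_fun_bool true); rewrite setTI.
  rewrite [X in measurable X](_ : _ = [set w | Z 0%:nng w = k] `*` setT).
    by apply: measurableX => //; exact: hk.
  by apply/seteqP; split => -[w u] /= => [/eqP|[/eqP]].
move=> u _; split => [w|s]; first by case: ifP => // _; exact: leey.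
have [tus|tus] := leP (t u) s%:num%:E.
  rewrite [X in <<s _ >> X](_ : _ = [set w | Z 0%:nng w = k]).
    by apply: hk => /=.
  apply/seteqP; split => w /=; last by move=> ->; rewrite eqxx.
  by case: eqP => //; rewrite leye_eq.
rewrite [X in <<s _ >> X](_ : _ = set0); first exact: sigma_algebra0.
apply/seteqP; split => w //=; case: eqP => _; last by rewrite leye_eq.
by rewrite leNgt tus.
Qed.

End stopping_times.

(** * Averages over the randomization device *)

Section unit_interval_mean.
Context {R : realType}.
Local Notation leb := (@lebesgue_measure R).
Local Notation I01 := (`[0%R, 1%R]%classic : set R).

Definition mean (g : R -> R) : R := \int[leb]_(x in I01) g x.

Definition bounded_measurable (g : R -> R) :=
  measurable_fun I01 g /\ exists M : R, forall x : R, 0 <= x <= 1 -> `|g x| <= M.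

Let measurable_I01 : measurable I01. Proof. exact: measurable_itv. Qed.

Let leb_I01 : leb I01 = 1%E.
Proof. by rewrite lebesgue_measure_itv/= lte01 oppr0 adde0. Qed.

Let leb_I01_lty : (leb I01 < +oo)%E. Proof. by rewrite leb_I01 ltry. Qed.

Lemma integrable_bounded_measurable g :
  bounded_measurable g -> leb.-integrable I01 (EFin \o g).
Proof.
move=> [mg [M gM]]; apply: measurable_bounded_integrable => //.
exists M; split; rewrite ?num_real// => N MN x x01.
by rewrite /= (le_trans _ (ltW MN))// gM.
Qed.

Lemma EFin_mean g : bounded_measurable g ->
  (\int[leb]_(x in I01) (g x)%:E = (mean g)%:E)%E.
Proof.
move=> /integrable_bounded_measurable ig.
by rewrite [RHS]fineK//; exact: integrable_fin_num ig.
Qed.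

Lemma bounded_measurable_cst c : bounded_measurable (cst c).
Proof. by split => //; exists `|c|. Qed.

Lemma bounded_measurableZ c g : bounded_measurable g ->
  bounded_measurable (fun x => c * g x).
Proof.
move=> [mg [M gM]]; split; first exact: measurable_funM.
by exists (`|c| * M) => x x01; rewrite normrM ler_wpM2l// gM.
Qed.

Lemma bounded_measurableD g1 g2 :
  bounded_measurable g1 -> bounded_measurable g2 ->
  bounded_measurable (fun x => g1 x + g2 x).
Proof.
move=> [mg1 [M1 gM1]] [mg2 [M2 gM2]]; split; first exact: measurable_funD.
by exists (M1 + M2) => x x01; rewrite (le_trans (ler_normD _ _))// lerD// ?gM1 ?gM2.
Qed.

Lemma mean_cst c : mean (cst c) = c.
Proof.
rewrite /mean Rintegral_cst// -[RHS]mulr1; congr (_ * _).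
exact: (congr1 fine leb_I01).
Qed.

Lemma meanZ c g : bounded_measurable g -> mean (fun x => c * g x) = c * mean g.
Proof.
by move=> /integrable_bounded_measurable bg; exact: RintegralZl.
Qed.

Lemma meanD g1 g2 : bounded_measurable g1 -> bounded_measurable g2 ->
  mean (fun x => g1 x + g2 x) = mean g1 + mean g2.
Proof.
move=> /integrable_bounded_measurable bg1 /integrable_bounded_measurable bg2.
exact: RintegralD.
Qed.

Lemma le_mean g1 g2 : bounded_measurable g1 -> bounded_measurable g2 ->
  (forall x, 0 <= x <= 1 -> g1 x <= g2 x) -> mean g1 <= mean g2.
Proof.
move=> /integrable_bounded_measurable bg1 /integrable_bounded_measurable bg2 g12.
by apply: le_Rintegral => // x /= x01; apply: g12; rewrite in_itv/= in x01.
Qed.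

Section iterated.
Context (F : R -> R -> R) (M : R).
Hypothesis mF : measurable_fun setT (fun z : R * R => F z.1 z.2).
Hypothesis FM : forall u v, `|F u v| <= M.

Let G : R * R -> \bar R := (EFin \o (fun z : R * R => F z.1 z.2)) \_ (I01 `*` I01).

Lemma integrable_iterated : (leb \x leb)%E.-integrable setT G.
Proof.
have m2 : measurable (I01 `*` I01) by exact: measurableX.
apply: (integrable_mkcond (mu := (leb \x leb)%E)
  (EFin \o (fun z => F z.1 z.2)) m2).1.
apply: measurable_bounded_integrable => //.
- apply: (@le_lt_trans _ _ (leb I01 * leb I01)%E).
    by rewrite -product_measure1E.
  by rewrite leb_I01 mule1 ltry.
- exact: measurable_funTS.
- exists M; split; rewrite ?num_real// => N MN x _.
  by rewrite /= (le_trans _ (ltW MN))// FM.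
Qed.

Lemma bounded_measurable_section u : bounded_measurable (F u).
Proof.
split; last by exists M.
by apply: measurable_funTS; exact: (measurableT_comp mF (pair1_measurable u)).
Qed.

Let GE u v : G (u, v) = (((fun v => ((F u v)%:E)) \_ I01) v * (\1_I01 u)%:E)%E.
Proof.
rewrite /G !patchE indicE in_setX/=.
by case: (u \in _) => /=; [rewrite mule1|rewrite mule0].
Qed.

Let inner_G u : (\int[leb]_v G (u, v))%E = ((mean (F u))%:E * (\1_I01 u)%:E)%E.
Proof.
under eq_integral do rewrite GE.
rewrite integralZr//; last first.
  apply: (integrable_mkcond (mu := leb) (fun v => (F u v)%:E) measurable_I01).1.
  exact/integrable_bounded_measurable/bounded_measurable_section.
by rewrite -integral_mkcond EFin_mean//; exact: bounded_measurable_section.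
Qed.

(** Measurability in [u] is that of the partial integral of [G] in the Fubini theorem, which agrees
    with the mean on [0, 1]. *)
Lemma bounded_measurable_mean : bounded_measurable (fun u => mean (F u)).
Proof.
split.
  have := measurable_fubini_F integrable_iterated.
  move=> /(measurable_funTS (D := I01)) mG; apply/measurable_EFinP.
  apply: eq_measurable_fun mG => u u01.
  by rewrite /fubini_F inner_G indicE u01 mule1.
exists M => u _; have M0 : 0 <= M by exact: le_trans (FM 0 0).
apply: le_trans; first apply: le_normr_Rintegral => //.
  exact/integrable_bounded_measurable/bounded_measurable_section.
rewrite -[leRHS]mean_cst; apply: le_mean => //; last exact: bounded_measurable_cst.
have [mFu _] := bounded_measurable_section u.
by split; [exact: measurableT_comp|exists M => x _; rewrite normr_id].
Qed.

Lemma integral_mean :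
  (\int[leb]_u \int[leb]_v G (u, v))%E = (mean (fun u => mean (F u)))%:E.
Proof.
rewrite -EFin_mean; last exact: bounded_measurable_mean.
rewrite [RHS]integral_mkcond; apply: eq_integral => u _.
rewrite inner_G patchE indicE; case: (u \in _); first by rewrite mule1.
by rewrite mule0.
Qed.

End iterated.

Lemma mean_Fubini (F : R -> R -> R) (M : R) :
  measurable_fun setT (fun z : R * R => F z.1 z.2) ->
  (forall u v, `|F u v| <= M) ->
  mean (fun u => mean (F u)) = mean (fun v => mean (F ^~ v)).
Proof.
move=> mF FM.
have mF' : measurable_fun setT (fun z : R * R => F z.2 z.1).
  exact: (measurableT_comp mF (measurable_fun_pair measurable_snd measurable_fst)).
apply: EFin_inj; rewrite -(integral_mean mF FM).
rewrite -(integral_mean (F := fun v u => F u v) mF' (fun v u => FM u v)).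
rewrite (Fubini (integrable_iterated mF FM)).
apply: eq_integral => v _; apply: eq_integral => u _.
by rewrite !patchE !in_setX/= andbC.
Qed.

End unit_interval_mean.

(** * Payoff for fixed types and deterministic times *)

(** This is [J] along constant paths: [t] is the time of the maximizer, [s] that of the minimizer,
    and [a], [b] are the values of [f], [h] at the types. A finite tie pays [b]. *)
Definition payoff {R : realType} (r a b : R) (t s : \bar R) : R :=
  if (s < t)%E then expR (- r * `|fine s|) * a
  else if (t < +oo)%E then expR (- r * `|fine t|) * b
  else 0.

Lemma payoff_bounded (R : realType) (r a b : R) (t s : \bar R) :
  0 < r -> `|payoff r a b t s| <= `|a| + `|b|.
Proof.
move=> r0; have e1 (x c : R) : `|expR (- r * `|x|) * c| <= `|c|.
  rewrite normrM ger0_norm ?expR_ge0// ler_piMl// -expR0 ler_expR.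
  by rewrite mulNr oppr_le0 mulr_ge0// ltW.
rewrite /payoff; case: ifP => _; first by rewrite (le_trans (e1 _ _))// lerDl.
case: ifP => _; first by rewrite (le_trans (e1 _ _))// lerDr.
by rewrite normr0 addr_ge0.
Qed.

Lemma measurable_payoff d (T : measurableType d) (R : realType) (r a b : R)
    (t s : T -> \bar R) :
  measurable_fun setT t -> measurable_fun setT s ->
  measurable_fun setT (fun x => payoff r a b (t x) (s x)).
Proof.
have me c (g : T -> \bar R) : measurable_fun setT g ->
    measurable_fun setT (fun x => expR (- r * `|fine (g x)|) * c).
  move=> mg; apply: measurable_funM => //; apply: measurableT_comp => //.
  apply: measurable_funM => //; apply: measurableT_comp => //.
  exact: (measurableT_comp (fine_measurable measurableT) mg).
move=> mt ms; apply: measurable_fun_ifT; [exact: measurable_fun_lte|exact: me|].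
apply: measurable_fun_ifT; [|exact: me|by []].
exact: measurable_fun_lte.
Qed.

(** * The randomized time of the war of attrition *)

Section threshold_mean.
Context {R : realType} (alpha c : R).
Hypotheses (alpha01 : 0 <= alpha <= 1) (c0 : 0 <= c).
Local Notation leb := (@lebesgue_measure R).

(* The randomized stopping time of an optimal strategy is [(2 / r) * ln (ramp v)],
   [v] uniform on [0, 1]: it has an atom of mass [alpha] at 0, and its discount
   factor is [ramp v ^- 2]. *)
Definition ramp (v : R) : R := 1 + c * Num.max 0 (v - alpha).

Lemma ramp_ge1 v : 1 <= ramp v.
Proof. by rewrite lerDl mulr_ge0// le_max lexx. Qed.

Lemma measurable_ramp : measurable_fun setT ramp.
Proof.
apply: measurable_funD => //; apply: measurable_funM => //.
by apply: measurable_maxr => //; exact: measurable_funB.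
Qed.

(** The right-hand side, as a function of [V], is an antiderivative of the integrand that vanishes
    at [alpha] and makes sense for [c = 0] too. *)
Lemma integral_ramp V : alpha <= V ->
  \int[leb]_(v in `[alpha, V]) (ramp v) ^- 2 =
  (V - alpha) / (1 + c * (V - alpha)).
Proof.
rewrite le_eqVlt => /predU1P[<-|aV].
  by rewrite set_itv1 Rintegral_set1 subrr mul0r.
pose D v := 1 + c * (v - alpha).
have D0 v : alpha <= v -> 0 < D v.
  by move=> av; rewrite ltr_pwDl// mulr_ge0// subr_ge0.
pose F v := (v - alpha) * (D v)^-1.
have dF v : alpha <= v -> is_derive v 1 F (D v ^- 2).
  move=> av; have Dv : D v != 0 by rewrite gt_eqF// D0.
  have dD : is_derive v 1 D c.
    by apply: is_derive_eq; rewrite add0r mul1r subr0 /GRing.scale/= mulr1.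
  have dV := is_deriveV Dv dD.
  have dS : is_derive v 1 (fun v : R => v - alpha) 1.
    by apply: is_derive_eq; rewrite subr0.
  have dM := is_deriveM dS dV.
  apply: (is_derive_eq dM).
  rewrite /GRing.scale/= mulr1.
  by move: Dv; rewrite /D => Dv; field.
have cF v : alpha <= v -> {for v, continuous F}.
  move=> av; apply: differentiable_continuous; apply/derivable1_diffP.
  by have [] := dF v av.
have cf v : alpha <= v -> {for v, continuous (fun v => D v ^- 2)}.
  move=> av; apply: differentiable_continuous; apply/derivable1_diffP.
  have Dv : D v ^+ 2 != 0 by rewrite expf_neq0// gt_eqF// D0.
  exact: derivableV.
have FTC : (\int[leb]_(v in `[alpha, V]) (D v ^- 2)%:E = (F V)%:E - (F alpha)%:E)%E.
  apply: continuous_FTC2 => //.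
  - apply: continuous_in_subspaceT => v; rewrite inE/= in_itv/= => /andP[av _].
    exact: cf.
  - split.
    + by move=> v; rewrite in_itv/= => /andP[/ltW av _]; have [] := dF v av.
    + by apply: cvg_at_right_filter; exact: cF.
    + by apply: cvg_at_left_filter; apply: cF; exact: ltW.
  - move=> v; rewrite in_itv/= => /andP[/ltW av _].
    by have /@derive_val := dF v av; rewrite derive1E.
apply: (@etrans _ _ (\int[leb]_(v in `[alpha, V]) (D v ^- 2))).
  apply: eq_Rintegral => v; rewrite inE/= in_itv/= => /andP[av _].
  by rewrite /ramp max_r ?subr_ge0.
by rewrite /Rintegral FTC -EFinB/= /F subrr mul0r subr0.
Qed.

(** The exponential form gives measurability by composition. *)
Lemma rampVE v : ramp v ^- 2 = expR (- (2 * ln (ramp v))).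
Proof.
rewrite expRN expRM_natl lnK// posrE.
exact: lt_le_trans ltr01 (ramp_ge1 v).
Qed.

Lemma rampV_le1 v : ramp v ^- 2 <= 1.
Proof.
rewrite invf_le1 ?exprn_ege1 ?ramp_ge1// exprn_gt0//.
exact: lt_le_trans ltr01 (ramp_ge1 v).
Qed.

Lemma bounded_measurable_rampV : bounded_measurable (fun v => ramp v ^- 2).
Proof.
split.
  apply: measurable_funTS; under eq_fun do rewrite rampVE.
  apply: measurableT_comp => //; apply: measurableT_comp => //.
  apply: measurable_funM => //.
  exact: (measurableT_comp (@measurable_ln R) measurable_ramp).
exists 1 => v _; rewrite ger0_norm ?rampV_le1// invr_ge0.
by rewrite exprn_ge0// (le_trans ler01 (ramp_ge1 v)).
Qed.

Let fine_leb (b1 b2 : bool) (x y : R) : x <= y ->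
  fine (leb [set` Interval (BSide b1 x) (BSide b2 y)]) = y - x.
Proof.
move=> xy; rewrite lebesgue_measure_itv/= lte_fin.
by case: ltgtP xy => // -> _; rewrite subrr.
Qed.

(** The integral is split at [V] and at [alpha]: [ramp] is 1 up to [alpha], which contributes the
    mass of the atom, and [integral_ramp] covers the rest up to [V]. The value of [g] at [V] is left
    free, a point being null. *)
Lemma mean_threshold V a b (g : R -> R) : alpha <= V <= 1 ->
  bounded_measurable g ->
  (forall v, 0 <= v < V -> g v = a * ramp v ^- 2) ->
  (forall v, V < v <= 1 -> g v = b) ->
  mean g = a * (alpha + (V - alpha) / (1 + c * (V - alpha))) + b * (1 - V).
Proof.
move=> /andP[aV V1] bg gl gr; have /andP[alpha0 _] := alpha01.
have V0 : 0 <= V by exact: le_trans aV.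
have ig := integrable_bounded_measurable bg.
have ir := integrable_bounded_measurable bounded_measurable_rampV.
have := Rintegral_itvB (x := V) ig; rewrite !bnd_simp => /(_ V0 V1).
rewrite -/(mean g) => /eqP; rewrite subr_eq addrC => /eqP ->; congr (_ + _).
- have ig1 : leb.-integrable `[0, V[ (EFin \o g).
    apply: integrableS ig => //; apply: subset_itvl; rewrite bnd_simp//.
  have ir1 : leb.-integrable `[0, V] (EFin \o (fun v => ramp v ^- 2)).
    by apply: integrableS ir => //; apply: subset_itvl; rewrite bnd_simp.
  have ir2 : leb.-integrable `[0, V[ (EFin \o (fun v => ramp v ^- 2)).
    by apply: integrableS ir1 => //; apply: subset_itvl; rewrite bnd_simp.
  rewrite -Rintegral_itv_bndo_bndc//.
  apply: (@etrans _ _ (\int[leb]_(v in `[0, V[) (a * ramp v ^- 2))).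
    by apply: eq_Rintegral; move=> v; rewrite inE/= in_itv/=; exact: gl.
  rewrite RintegralZl// Rintegral_itv_bndo_bndc//; congr (_ * _).
  have := Rintegral_itvB (x := alpha) ir1; rewrite !bnd_simp => /(_ alpha0 aV).
  move=> /eqP; rewrite subr_eq addrC => /eqP ->; congr (_ + _).
    apply: (@etrans _ _ (\int[leb]_(v in `[0, alpha]) 1)).
      apply: eq_Rintegral; move=> v; rewrite inE/= in_itv/= => /andP[_ va].
      by rewrite /ramp max_l ?subr_le0// mulr0 addr0 expr1n invr1.
    rewrite Rintegral_cst// mul1r -[RHS]subr0; exact: fine_leb.
  rewrite Rintegral_itv_obnd_cbnd ?integral_ramp//.
  apply: integrableS ir1 => //.
  by apply: subset_itv; rewrite bnd_simp.
- apply: (@etrans _ _ (\int[leb]_(v in `]V, 1]) b)).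
    by apply: eq_Rintegral; move=> v; rewrite inE/= in_itv/=; exact: gr.
  rewrite Rintegral_cst//; congr (_ * _); exact: fine_leb.
Qed.

Lemma mean_rampV :
  mean (fun v => ramp v ^- 2) = alpha + (1 - alpha) / (1 + c * (1 - alpha)).
Proof.
have /andP[_ alpha1] := alpha01.
rewrite (@mean_threshold 1 1 0)//.
- by rewrite mul1r mul0r addr0.
- by rewrite alpha1 lexx.
- exact: bounded_measurable_rampV.
- by move=> v _; rewrite mul1r.
- by move=> v /andP[v1 v1']; have := lt_le_trans v1 v1'; rewrite ltxx.
Qed.

Lemma bounded_measurable_stop (y : R) :
  bounded_measurable
    (fun v => if y * ramp v <= 1 then ramp v ^- 2 else - y ^+ 2).
Proof.
have [mr _] := bounded_measurable_rampV.
split.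
  apply: measurable_fun_if => //.
  - apply: measurable_fun_ler => //; apply: measurable_funTS.
    by apply: measurable_funM => //; exact: measurable_ramp.
  - by apply: measurable_funS mr => // v [].
exists (1 + y ^+ 2) => v _; case: ifP => _.
  rewrite ger0_norm ?(le_trans (rampV_le1 v)) ?lerDl ?sqr_ge0//.
  by rewrite invr_ge0 exprn_ge0// (le_trans ler01 (ramp_ge1 v)).
by rewrite normrN ger0_norm ?sqr_ge0// lerDr.
Qed.

(* With [y = e^{-rt/2}], the left-hand side is what an opponent of the indifferent
   type gains by stopping at [t]; under the balance condition it does not depend
   on [t] as long as [t] is in the support of the randomized stopping time. *)
Lemma ramp_balance (w0 w1 y : R) : 0 <= w0 -> 0 <= w1 -> 0 <= y <= 1 ->
  alpha = 1 \/ w1 * (1 + c * (1 - alpha)) = c * w0 ->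
  w0 * y ^+ 2 +
    w1 * mean (fun v => if y * ramp v <= 1 then ramp v ^- 2 else - y ^+ 2)
  <= w0 - w1 + 2 * w1 * alpha.
Proof.
move=> w00 w10 /andP[y0 y1] bal; have /andP[alpha0 alpha1] := alpha01.
have y21 : y ^+ 2 <= 1 by rewrite exprn_ile1.
have M1 : 1 <= 1 + c * (1 - alpha) by rewrite lerDl mulr_ge0// subr_ge0.
have ramp_le v V : alpha <= V -> v <= V -> ramp v <= 1 + c * (V - alpha).
  by move=> aV vV; rewrite lerD2l ler_wpM2l// ge_max subr_ge0 aV lerD2r.
(* The largest value of [ramp] on [0, 1] is [1 + c * (1 - alpha)], so the first case is that of an
   opponent who stops at or after the end of the support. *)
have [yM|yM] := leP (y * (1 + c * (1 - alpha))) 1.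
  rewrite (@mean_threshold 1 1 0) ?alpha1 ?lexx//; last 3 first.
  - exact: bounded_measurable_stop.
  - move=> v /andP[_ /ltW v1]; rewrite mul1r ifT//.
    by apply: le_trans yM; rewrite ler_wpM2l// ramp_le.
  - by move=> v /andP[v1 v1']; have := lt_le_trans v1 v1'; rewrite ltxx.
  rewrite mul1r mul0r addr0.
  have [a1|/eqP a1] := eqVneq alpha 1.
    rewrite a1 subrr mul0r addr0.
    have : w0 * y ^+ 2 <= w0 by rewrite ler_piMr.
    by lra.
  case: bal => // bal.
  have [c00|cn0] := eqVneq c 0.
    have w1E : w1 = 0 by move: bal; rewrite c00 !mul0r addr0 mulr1.
    by rewrite w1E !(mul0r, mulr0, addr0, subr0) ler_piMr.
  have w0E : w0 = w1 * (1 + c * (1 - alpha)) / c by rewrite bal mulrAC mulfV ?mul1r.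
  set M := 1 + c * (1 - alpha) in M1 yM w0E *.
  have Mn0 : M != 0 by rewrite gt_eqF// (lt_le_trans ltr01).
  (* Past the end of the support, delay only shrinks the first term, so the worst case is
     [y = M^-1], where equality holds. *)
  have yM2 : y ^+ 2 <= M ^- 2.
    rewrite -exprVn; apply: lerXn2r; rewrite ?nnegrE ?invr_ge0 ?(le_trans ler01 M1)//.
    by rewrite -[M^-1]mul1r ler_pdivlMr// (lt_le_trans ltr01).
  have aE : alpha = 1 - (M - 1) / c by rewrite /M; field.
  apply: (@le_trans _ _ (w0 * M ^- 2 + w1 * (alpha + (1 - alpha) / M))).
    by rewrite lerD2r ler_wpM2l.
  rewrite le_eqVlt; apply/orP; left; apply/eqP; rewrite w0E aE; field.
  by rewrite cn0.
(* With [alpha = 1] the support is reduced to time 0, so a [y] above 1 would be required here. *)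
have {bal}bal : w1 * (1 + c * (1 - alpha)) = c * w0.
  by case: bal => // a1; move: yM; rewrite a1 subrr mulr0 addr0 mulr1 ltNge y1.
have cn0 : c != 0.
  by apply: contraTneq yM => ->; rewrite mul0r addr0 mulr1 -leNgt.
have yn0 : y != 0 by apply: contraTneq yM => ->; rewrite mul0r -leNgt.
have cp : 0 < c by rewrite lt_neqAle eq_sym cn0.
have yp : 0 < y by rewrite lt_neqAle eq_sym yn0.
(* At [v = alpha + d] the function [ramp] reaches [y^-1]: the randomized time is at most [t] exactly
   for [v] up to this level. *)
pose d := (y^-1 - 1) / c.
have d0 : 0 <= d by rewrite divr_ge0// subr_ge0 invf_ge1.
have yd : y * (1 + c * d) = 1 by rewrite /d; field; rewrite cn0 yn0.
have d1 : d <= 1 - alpha.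
  rewrite ler_pdivrMr// lerBlDl -[_^-1]mul1r ler_pdivrMr// mulrC.
  by rewrite (mulrC _ c) ltW.
rewrite (@mean_threshold (alpha + d) 1 (- y ^+ 2)); last 4 first.
- by rewrite lerDl d0 -lerBrDl.
- exact: bounded_measurable_stop.
- move=> v /andP[_ /ltW vV]; rewrite mul1r ifT//.
  rewrite -yd ler_wpM2l//; apply: (le_trans (ramp_le v (alpha + d) _ vV)).
    by rewrite lerDl.
  by rewrite addrAC subrr add0r.
- move=> v /andP[Vv _]; rewrite ifF//; apply/negbTE; rewrite -ltNge -yd.
  rewrite ltr_pM2l// ltrD2l ltr_pM2l// lt_max; apply/orP; right.
  by rewrite ltrBrDl.
rewrite mul1r [alpha + d - alpha]addrAC subrr add0r.
have -> : 1 + c * d = y^-1 by apply: (mulfI yn0); rewrite yd mulfV.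
(* Within the support the bound is an equality, which is the indifference. *)
rewrite invrK le_eqVlt; apply/orP; left; apply/eqP.
have w0E : w0 = w1 * (1 + c * (1 - alpha)) / c by rewrite bal mulrAC mulfV ?mul1r.
by rewrite w0E /d; field; rewrite cn0 yn0.
Qed.

End threshold_mean.

(** * Bounds against mixed strategies from bounds against deterministic times *)

Lemma mean_sum (R : realType) (I : Type) (s : seq I) (a : I -> R)
    (g : I -> R -> R) :
  (forall j, bounded_measurable (g j)) ->
  bounded_measurable (fun x => \sum_(j <- s) a j * g j x) /\
  mean (fun x => \sum_(j <- s) a j * g j x) = \sum_(j <- s) a j * mean (g j).
Proof.
move=> bg; elim: s => [|j s [bs ms]].
  under eq_fun do rewrite big_nil.
  rewrite big_nil; split; first exact: bounded_measurable_cst.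
  exact: mean_cst.
under eq_fun do rewrite big_cons.
have bj := bounded_measurableZ (a j) (bg j).
split; first exact: bounded_measurableD.
by rewrite meanD// meanZ// ms big_cons.
Qed.

(** The values outside [0, 1] are overwritten by 0, which gives measurability and nonnegativity on
    the whole line. *)
Lemma mixed_stopping_time_fun (R : realType) (T : pointedType) (n : nat)
    (Z : {nonneg R} -> T -> 'I_n.+1) (mu : T -> R -> \bar R) (w : T) :
  mixed_stopping_time Z mu ->
  exists a : R -> \bar R, [/\ measurable_fun setT a, forall u, (0 <= a u)%E &
    forall u, 0 <= u <= 1 -> a u = mu w u].
Proof.
move=> mmu; have mw := mixed_stopping_time_section w mmu.
have [_ st] := mmu.
exists (mu w \_ (`[0, 1]%classic : set R)); split.
- apply: (measurable_restrict (mu w) (measurable_itv _) measurableT).1.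
  by rewrite setTI.
- move=> u; rewrite patchE; case: ifPn => //.
  by rewrite inE/= in_itv/= => /st [].
- by move=> u u01; rewrite patchE ifT// inE/= in_itv.
Qed.

Section payoff_bounds.
Context {R : realType} {m n : nat} (r : R) (f h : 'I_m.+1 -> 'I_n.+1 -> R).
Hypothesis r0 : 0 < r.
Context (p : 'rV[R]_m.+1) (q : 'rV[R]_n.+1).
Context (PX : probability (path_space R m) R).
Context (PY : probability (path_space R n) R).
Hypotheses (hPX : markov_law p 0 PX) (hPY : markov_law q 0 PY).

Let P i j := payoff r (f i j) (h i j).

Lemma measurable_payoff_prod i j (a b : R -> \bar R) :
  measurable_fun setT a -> measurable_fun setT b ->
  measurable_fun setT (fun z : R * R => P i j (a z.1) (b z.2)).
Proof.
by move=> ma mb; apply: measurable_payoff;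
  [exact: (measurableT_comp ma measurable_fst)|
   exact: (measurableT_comp mb measurable_snd)].
Qed.

Lemma measurable_payoff_swap i j (a b : R -> \bar R) :
  measurable_fun setT a -> measurable_fun setT b ->
  measurable_fun setT (fun z : R * R => P i j (a z.2) (b z.1)).
Proof.
by move=> ma mb; apply: measurable_payoff;
  [exact: (measurableT_comp ma measurable_snd)|
   exact: (measurableT_comp mb measurable_fst)].
Qed.

Lemma Jbar_constant (mu nu : Omega R m n -> R -> \bar R) i j
    (a b : R -> \bar R) :
  measurable_fun setT a -> measurable_fun setT b ->
  (forall u, 0 <= u <= 1 -> a u = mu (constant_path i, constant_path j) u) ->
  (forall v, 0 <= v <= 1 -> b v = nu (constant_path i, constant_path j) v) ->
  Jbar r f h mu nu (constant_path i, constant_path j) =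
  (mean (fun v => mean (fun u => P i j (a u) (b v))))%:E.
Proof.
move=> ma mb amu bnu; have mP := measurable_payoff_swap i j ma mb.
have bP u v := payoff_bounded (f i j) (h i j) (a u) (b v) r0.
rewrite -EFin_mean; last first.
  exact: (bounded_measurable_mean mP (fun v u => bP u v)).
apply: eq_integral => v; rewrite inE/= in_itv/= => v01.
rewrite -EFin_mean; last first.
  exact: (bounded_measurable_section mP (fun v u => bP u v)).
apply: eq_integral => u; rewrite inE/= in_itv/= => u01.
by rewrite amu// bnu.
Qed.

(* Fubini reduces a bound against every mixed [mu] to one against every
   deterministic time [t]. *)
Lemma expected_payoff_le (b : 'I_n.+1 -> R -> \bar R) (c : 'I_m.+1 -> R)
    (mu : Omega R m n -> R -> \bar R) :
  (forall i, 0 <= p ord0 i) ->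
  (forall j, measurable_fun setT (b j)) ->
  (forall i t, (0 <= t)%E ->
     \sum_j q ord0 j * mean (fun v => P i j t (b j v)) <= c i) ->
  mixed_stopping_time (@X R m n) mu ->
  (expected_payoff r f h PX PY mu (fun w => b (Y (0%:nng)%R w)) <=
   (\sum_i p ord0 i * c i)%:E)%E.
Proof.
move=> p0 mb bc mmu.
(* The time of [mu] is read at the opponent type [ord0]; by adaptedness it is the same at every
   other type [j]. *)
have /choice[a aP] : forall i, exists a : R -> \bar R,
    [/\ measurable_fun setT a, forall u, (0 <= a u)%E &
    forall u, 0 <= u <= 1 -> a u = mu (constant_path i, constant_path ord0) u].
  by move=> i; exact: mixed_stopping_time_fun mmu.
have ma i : measurable_fun setT (a i) by have [] := aP i.
have a0 i u : (0 <= a i u)%E by have [] := aP i.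
have amu i j u : 0 <= u <= 1 -> a i u = mu (constant_path i, constant_path j) u.
  move=> u01; have [_ _ ->//] := aP i; have [_ st] := mmu.
  exact: stopping_time_adapted (st u u01) _.
rewrite (expected_payoff_constant (g := fun i j =>
  mean (fun v => mean (fun u => P i j (a i u) (b j v)))) hPX hPY); last first.
  by move=> i j; apply: Jbar_constant => //; exact: amu.
rewrite lee_fin /bilinear_ext; apply: ler_sum => i _.
under eq_bigr do rewrite -mulrA.
rewrite -mulr_sumr ler_wpM2l//.
have bP j u v := payoff_bounded (f i j) (h i j) (a i u) (b j v) r0.
have mP j := measurable_payoff_prod i j (ma i) (mb j).
(* The exchange puts the average over [u] outside, so that the inner expression is the payoff
   against the deterministic time [a i u]. *)
under eq_bigr => j _.
  rewrite -(mean_Fubini (mP j) (bP j)).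
  over.
have [bs <-] := mean_sum (index_enum _) (q ord0)
  (fun j => bounded_measurable_mean (mP j) (bP j)).
rewrite -[leRHS]mean_cst; apply: le_mean => //.
  exact: bounded_measurable_cst.
by move=> u _; exact: bc.
Qed.

(** [Jbar] has the average over [v] outside already, so it is directly an average over deterministic
    times [b j v] of the minimizer. *)
Lemma expected_payoff_ge (a : 'I_m.+1 -> R -> \bar R) (c : 'I_n.+1 -> R)
    (nu : Omega R m n -> R -> \bar R) :
  (forall j, 0 <= q ord0 j) ->
  (forall i, measurable_fun setT (a i)) ->
  (forall j s, (0 <= s)%E ->
     c j <= \sum_i p ord0 i * mean (fun u => P i j (a i u) s)) ->
  mixed_stopping_time (@Y R m n) nu ->
  ((\sum_j q ord0 j * c j)%:E <=
   expected_payoff r f h PX PY (fun w => a (X (0%:nng)%R w)) nu)%E.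
Proof.
move=> q0 ma bc mnu.
have /choice[b bP] : forall j, exists b : R -> \bar R,
    [/\ measurable_fun setT b, forall v, (0 <= b v)%E &
    forall v, 0 <= v <= 1 -> b v = nu (constant_path ord0, constant_path j) v].
  by move=> j; exact: mixed_stopping_time_fun mnu.
have mb j : measurable_fun setT (b j) by have [] := bP j.
have b0 j v : (0 <= b j v)%E by have [] := bP j.
have bnu i j v : 0 <= v <= 1 -> b j v = nu (constant_path i, constant_path j) v.
  move=> v01; have [_ _ ->//] := bP j; have [_ st] := mnu.
  exact: stopping_time_adapted (st v v01) _.
rewrite (expected_payoff_constant (g := fun i j =>
  mean (fun v => mean (fun u => P i j (a i u) (b j v)))) hPX hPY); last first.
  by move=> i j; apply: Jbar_constant => //; exact: bnu.
rewrite lee_fin /bilinear_ext exchange_big/=; apply: ler_sum => j _.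
under [leRHS]eq_bigr do rewrite mulrAC mulrC.
rewrite -mulr_sumr ler_wpM2l//.
have bdP i u v := payoff_bounded (f i j) (h i j) (a i u) (b j v) r0.
have mP i := measurable_payoff_swap i j (ma i) (mb j).
have [bs <-] := mean_sum (index_enum _) (p ord0)
  (fun i => bounded_measurable_mean (mP i) (fun v u => bdP i u v)).
rewrite -[leLHS]mean_cst; apply: le_mean => //.
  exact: bounded_measurable_cst.
by move=> v _; exact: bc.
Qed.

End payoff_bounds.

(** Each strategy bounds one of the two iterated values directly and, being available as a reply to
    every opponent, bounds the other one as well. *)
Lemma game_value (R : realType) (m n : nat) (r : R)
    (f h : 'I_m.+1 -> 'I_n.+1 -> R)
    (PX : probability (path_space R m) R) (PY : probability (path_space R n) R)
    (V : R) :
  (exists2 nu, mixed_stopping_time (@Y R m n) nu &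
     forall mu, mixed_stopping_time (@X R m n) mu ->
       (expected_payoff r f h PX PY mu nu <= V%:E)%E) ->
  (exists2 mu, mixed_stopping_time (@X R m n) mu &
     forall nu, mixed_stopping_time (@Y R m n) nu ->
       (V%:E <= expected_payoff r f h PX PY mu nu)%E) ->
  is_game_value r f h PX PY V.
Proof.
move=> [nu0 mnu0 le0] [mu0 mmu0 ge0]; split; apply/eqP; rewrite eq_le.
- apply/andP; split.
    apply: (@le_trans _ _ (ereal_sup
      [set expected_payoff r f h PX PY mu nu0 | mu in mixed_stopping_time (@X R m n)])).
      by apply: ereal_inf_lbound; exists nu0.
    by apply: ge_ereal_sup => _ [mu mmu <-]; exact: le0.
  apply: le_ereal_inf_tmp => _ [nu mnu <-].
  apply: le_trans (ge0 nu mnu) _.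
  by apply: ereal_sup_ubound; exists mu0.
- apply/andP; split.
    apply: ge_ereal_sup => _ [mu mmu <-].
    apply: le_trans (le0 mu mmu).
    by apply: ereal_inf_lbound; exists nu0.
  apply: (@le_trans _ _ (ereal_inf
    [set expected_payoff r f h PX PY mu0 nu | nu in mixed_stopping_time (@Y R m n)])).
    by apply: le_ereal_inf_tmp => _ [nu mnu <-]; exact: ge0.
  by apply: ereal_sup_ubound; exists mu0.
Qed.

(** * Discount factors as a change of variable *)

Section discounting.
Context {R : realType} (r : R).
Hypothesis r0 : 0 < r.

(* [half_discount t ^+ 2] is the discount factor [e^{-rt}], with value 0 at infinity. *)
Definition half_discount (t : \bar R) : R :=
  if t is s%:E then expR (- (r / 2 * s)) else 0.

Lemma half_discount01 t : (0 <= t)%E -> 0 <= half_discount t <= 1.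
Proof.
case: t => [s| |]//; rewrite /= ?lexx ?ler01// lee_fin => s0.
by rewrite expR_ge0 -expR0 ler_expR oppr_le0 mulr_ge0// divr_ge0// ltW.
Qed.

Lemma le_half_discount s t : (0 <= s)%E -> (0 <= t)%E ->
  (half_discount t <= half_discount s) = (s <= t)%E.
Proof.
case: s => [s| |]//; case: t => [t| |]//= s0 t0.
- by rewrite ler_expR lerN2 ler_pM2l ?divr_gt0// lee_fin.
- by rewrite expR_ge0 leey.
- by rewrite leNgt expR_gt0 leye_eq.
- by rewrite lexx leey.
Qed.

(** With discount factor 0 at infinity, the case where nobody stops merges into the case
    [t <= s]. *)
Lemma payoffE a b t s : (0 <= t)%E -> (0 <= s)%E ->
  payoff r a b t s =
  if (s < t)%E then half_discount s ^+ 2 * a else half_discount t ^+ 2 * b.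
Proof.
have E x : 0 <= x -> expR (- r * `|x|) = expR (- (r / 2 * x)) ^+ 2.
  by move=> x0; rewrite -expRM_natl ger0_norm//; congr expR; field.
move=> t0 s0; rewrite /payoff; have [st|ts] := ltP s t.
  case: s s0 st => [s| |]//= s0 st; first by rewrite E.
  by move: st; rewrite ltNge leey.
case: t t0 ts => [t| |]//= t0 ts; last by rewrite expr0n mul0r.
by rewrite ltry E.
Qed.

Definition stop_time (alpha c v : R) : \bar R :=
  (2 / r * ln (ramp alpha c v))%:E.

Section stop_time.
Context (alpha c : R) (c0 : 0 <= c).

Lemma stop_time_ge0 v : (0 <= stop_time alpha c v)%E.
Proof. by rewrite lee_fin mulr_ge0 ?divr_ge0 ?ln_ge0 ?ramp_ge1// ltW. Qed.

Lemma measurable_stop_time : measurable_fun setT (stop_time alpha c).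
Proof.
apply/measurable_EFinP; apply: measurable_funM => //.
exact: (measurableT_comp (@measurable_ln R) (measurable_ramp alpha c)).
Qed.

Lemma half_discount_stop_time v :
  half_discount (stop_time alpha c v) = (ramp alpha c v)^-1.
Proof.
rewrite /= mulrA [X in X * _](_ : _ = 1); last by field; rewrite gt_eqF.
rewrite mul1r expRN lnK// posrE.
exact: lt_le_trans ltr01 (ramp_ge1 alpha c0 v).
Qed.

(** Stopping by time [t] becomes the condition under which the integrand of [ramp_balance] is
    [ramp v ^- 2]. *)
Lemma stop_time_le t v : (0 <= t)%E ->
  (stop_time alpha c v <= t)%E = (half_discount t * ramp alpha c v <= 1).
Proof.
move=> t0; rewrite -le_half_discount ?stop_time_ge0// half_discount_stop_time.
by rewrite -[_^-1]mul1r ler_pdivlMr// (lt_le_trans ltr01 (ramp_ge1 alpha c0 v)).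
Qed.

Lemma bounded_measurable_payoffl a b t :
  bounded_measurable (fun v => payoff r a b t (stop_time alpha c v)).
Proof.
split; last by exists (`|a| + `|b|) => v _; exact: payoff_bounded.
by apply: measurable_funTS; apply: measurable_payoff => //; exact: measurable_stop_time.
Qed.

Lemma bounded_measurable_payoffr a b s :
  bounded_measurable (fun v => payoff r a b (stop_time alpha c v) s).
Proof.
split; last by exists (`|a| + `|b|) => v _; exact: payoff_bounded.
by apply: measurable_funTS; apply: measurable_payoff => //; exact: measurable_stop_time.
Qed.

End stop_time.
End discounting.

(** * Guarantees of the explicit strategies with two types *)

Lemma bilinear_ext_law2 (R : realType) (g : 'I_2 -> 'I_2 -> R) (p q : R) :
  bilinear_ext g (law2 p) (law2 q) =
  p * q * g ord0 ord0 + p * (1 - q) * g ord0 ord_max +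
  ((1 - p) * q * g ord_max ord0 + (1 - p) * (1 - q) * g ord_max ord_max).
Proof.
have e : lift ord0 ord0 = ord_max :> 'I_2 by exact/val_inj.
by rewrite /bilinear_ext !big_ord_recl !big_ord0 !e !mxE/= !addr0.
Qed.

Lemma sum_law2 (R : realType) (p : R) (g : 'I_2 -> R) :
  \sum_i law2 p ord0 i * g i = p * g ord0 + (1 - p) * g ord_max.
Proof.
have e : lift ord0 ord0 = ord_max :> 'I_2 by exact/val_inj.
by rewrite !big_ord_recl !big_ord0 !e !mxE/= !addr0.
Qed.

Lemma law2_ge0 (R : realType) (p : R) (i : 'I_2) :
  0 <= p <= 1 -> 0 <= law2 p ord0 i.
Proof. by move=> /andP[p0 p1]; rewrite mxE; case: ifP; rewrite ?subr_ge0. Qed.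

Lemma ord2_case (P : 'I_2 -> Prop) : P ord0 -> P ord_max -> forall i, P i.
Proof.
move=> P0 P1 [[|[|//]] i2]; first by rewrite (_ : Ordinal _ = ord0)//; apply/val_inj.
by rewrite (_ : Ordinal _ = ord_max)//; apply/val_inj.
Qed.

Section example_game.
Context {R : realType} (r : R) (f h : 'I_2 -> 'I_2 -> R) (p q : R).
Hypotheses (r0 : 0 < r) (p01 : 0 <= p <= 1) (q01 : 0 <= q <= 1).
Hypotheses (h00 : h ord0 ord0 = 1) (h01 : h ord0 ord_max = -1)
  (h10 : h ord_max ord0 = -2) (h11 : h ord_max ord_max = -4).
Hypotheses (f00 : f ord0 ord0 = 4) (f01 : f ord0 ord_max = 1)
  (f10 : f ord_max ord0 = 2) (f11 : f ord_max ord_max = -1).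
Context (PX PY : probability (path_space R 1) R).
Hypotheses (hPX : markov_law (law2 p) 0 PX) (hPY : markov_law (law2 q) 0 PY).

Let mX := mixed_stopping_time (@X R 1 1).
Let mY := mixed_stopping_time (@Y R 1 1).
Let E := expected_payoff r f h PX PY.

Lemma never_stop_mixed (Z : {nonneg R} -> Omega R 1 1 -> 'I_2) :
  mixed_stopping_time Z (fun _ _ => +oo%E).
Proof.
have := @mixed_stopping_time_start R _ _ Z ord0 (cst +oo%E)
  (measurable_cst _) (fun=> leey _).
by under eq_fun do under eq_fun do rewrite if_same.
Qed.

(** Against a minimizer who never stops, stopping brings a discounted 2q - 1 to the type X = 0 and
    2q - 4 to the type X = 1, both at most 0. *)
Lemma minimizer_never : 2^-1 <= p -> q <= 2^-1 ->
  exists2 nu, mY nu & forall mu, mX mu -> (E mu nu <= 0%:E)%E.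
Proof.
move=> p2 q2; exists (fun _ _ => +oo%E); first exact: never_stop_mixed.
move=> mu mmu.
have -> : 0%:E = (\sum_i law2 p ord0 i * (fun=> 0) i)%:E.
  by rewrite sum_law2 !mulr0 addr0.
apply: (expected_payoff_le r0 hPX hPY (b := fun _ _ => +oo%E)) => //.
  by move=> i; exact: law2_ge0.
move=> i t t0; rewrite sum_law2.
rewrite !(mean_cst (payoff _ _ _ _ _)) !payoffE ?leey// ltNge leey/=.
have := sqr_ge0 (half_discount r t).
set y2 := _ ^+ 2; move=> y20; have /andP[q0 q1] := q01.
elim/ord2_case: i; rewrite ?h00 ?h01 ?h10 ?h11; nra.
Qed.

(** Against a maximizer who never stops, stopping costs a discounted 2 + 2p to the type Y = 0 and 2p
    - 1 to the type Y = 1, both at least 0. *)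
Lemma maximizer_never : 2^-1 <= p -> q <= 2^-1 ->
  exists2 mu, mX mu & forall nu, mY nu -> (0%:E <= E mu nu)%E.
Proof.
move=> p2 q2; exists (fun _ _ => +oo%E); first exact: never_stop_mixed.
move=> nu mnu.
have -> : 0%:E = (\sum_i law2 q ord0 i * (fun=> 0) i)%:E.
  by rewrite sum_law2 !mulr0 addr0.
apply: (expected_payoff_ge r0 hPX hPY (a := fun _ _ => +oo%E)) => //.
  by move=> i; exact: law2_ge0.
move=> j s s0; rewrite sum_law2.
rewrite !(mean_cst (payoff _ _ _ _ _)) !payoffE ?leey//.
have := sqr_ge0 (half_discount r s).
have /andP[p0 p1] := p01.
case: ifP => _; last by rewrite /= expr0n !mul0r !mulr0 addr0.
set y2 := _ ^+ 2; move=> y20.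
elim/ord2_case: j; rewrite ?f00 ?f01 ?f10 ?f11; nra.
Qed.

Section randomized.
Context (alpha c : R) (alpha01 : 0 <= alpha <= 1) (c0 : 0 <= c).
Let tau := stop_time r alpha c.
(** By [mean_rampV], this is the expected discount factor at the randomized time [tau]. *)
Let A := alpha + (1 - alpha) / (1 + c * (1 - alpha)).

Let rampV_ge0 v : 0 <= ramp alpha c v ^- 2.
Proof. by rewrite invr_ge0 exprn_ge0// (le_trans ler01 (ramp_ge1 alpha c0 v)). Qed.

Let tauE v : half_discount r (tau v) ^+ 2 = ramp alpha c v ^- 2.
Proof. by rewrite half_discount_stop_time// exprVn. Qed.

Let late_stop t v : (0 <= t)%E -> (t <= tau v)%E ->
  ramp alpha c v ^- 2 <= half_discount r t ^+ 2.
Proof.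
move=> t0 ttau; have /andP[y0 _] := half_discount01 r0 t0.
rewrite -tauE ler_sqr ?nnegrE//; last first.
  by have /andP[] := half_discount01 r0 (stop_time_ge0 r0 alpha c0 v).
by rewrite le_half_discount// stop_time_ge0.
Qed.

(* Only the type [Y = 1] of the minimizer, for whom f can be negative, ever stops. *)
Lemma minimizer_randomized :
  alpha = 1 \/ (1 - q) * (1 + c * (1 - alpha)) = c * q ->
  exists2 nu, mY nu & forall mu, mX mu ->
    (E mu nu <= (p * (q - (1 - q) + 2 * (1 - q) * alpha)
                 - (1 - p) * (1 - q) * A)%:E)%E.
Proof.
move=> bal; pose b (j : 'I_2) v := if j == ord_max then tau v else +oo%E.
have mtau := measurable_stop_time r alpha c.
exists (fun w => b (Y (0%:nng)%R w)).
  by apply: mixed_stopping_time_start => // v; exact: stop_time_ge0.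
move=> mu mmu.
(* The type X = 0 faces [ramp_balance] with weights q and 1 - q; the type X = 1 does best by waiting
   for the -1 that Y = 1 pays at [tau]. *)
pose C (i : 'I_2) := if i == ord0 then q - (1 - q) + 2 * (1 - q) * alpha
  else - ((1 - q) * A).
have -> : p * (q - (1 - q) + 2 * (1 - q) * alpha) - (1 - p) * (1 - q) * A =
    \sum_i law2 p ord0 i * C i.
  by rewrite sum_law2 /C/= mulrN mulrA.
apply: (expected_payoff_le r0 hPX hPY (b := b)) => //.
- by move=> i; exact: law2_ge0.
- by move=> j; rewrite /b; apply: measurable_fun_ifT.
have /andP[q0 q1] := q01; have q1' : 0 <= 1 - q by rewrite subr_ge0.
move=> i t t0; rewrite sum_law2 /b/=.
rewrite (mean_cst (payoff _ _ _ _ _)) payoffE ?leey// ltNge leey/=.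
set y := half_discount r t; have y01 := half_discount01 r0 t0 : 0 <= y <= 1.
have bm a a' := bounded_measurable_payoffl r0 alpha c a a' t.
elim/ord2_case: i; rewrite /C /=.
- rewrite h00 h01 f01 mulr1.
  apply: le_trans (ramp_balance alpha01 c0 q0 q1' y01 bal).
  rewrite lerD2l ler_wpM2l//; apply: le_mean => //.
    exact: bounded_measurable_stop.
  move=> v _; rewrite payoffE ?stop_time_ge0//; case: ifPn => [vt|_].
    by rewrite -stop_time_le// (ltW vt) tauE mulr1.
  (* Only the tie [tau v = t] is left, where the payoff is negative and the bounding function is
     not. *)
  rewrite mulrN1; case: ifP => // _.
  by rewrite (le_trans _ (rampV_ge0 v))// oppr_le0 sqr_ge0.
- rewrite h10 h11 f11 -mulrN.
  have -> : - A = mean (fun v => -1 * ramp alpha c v ^- 2).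
    rewrite meanZ ?mean_rampV ?mulN1r//; exact: bounded_measurable_rampV.
  rewrite -[leRHS]add0r; apply: lerD.
    by rewrite mulr_ge0_le0// mulr_ge0_le0 ?sqr_ge0//; lra.
  rewrite ler_wpM2l//; apply: le_mean => //.
    by apply: bounded_measurableZ; exact: bounded_measurable_rampV.
  move=> v _; rewrite payoffE ?stop_time_ge0//; case: ifPn => [vt|].
    by rewrite tauE mulrC.
  rewrite -leNgt => /(late_stop t0); rewrite -/y.
  by have := rampV_ge0 v; lra.
Qed.

(* Only the type [X = 0] of the maximizer, for whom h can be positive, ever stops. *)
Lemma maximizer_randomized :
  alpha = 1 \/ p * (1 + c * (1 - alpha)) = c * (1 - p) ->
  exists2 mu, mX mu & forall nu, mY nu ->
    ((q * p * A - (1 - q) * (1 - p - p + 2 * p * alpha))%:E <= E mu nu)%E.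
Proof.
move=> bal; pose a (i : 'I_2) u := if i == ord0 then tau u else +oo%E.
have mtau := measurable_stop_time r alpha c.
exists (fun w => a (X (0%:nng)%R w)).
  by apply: mixed_stopping_time_start => // v; exact: stop_time_ge0.
move=> nu mnu.
(* Stopping costs the type Y = 0 at least 2 per discounted unit, so waiting for the 1 paid at [tau]
   is best; up to sign, Y = 1 faces [ramp_balance] with weights 1 - p and p. *)
pose C (j : 'I_2) := if j == ord0 then p * A
  else - (1 - p - p + 2 * p * alpha).
have -> : q * p * A - (1 - q) * (1 - p - p + 2 * p * alpha) =
    \sum_i law2 q ord0 i * C i.
  by rewrite sum_law2 /C/= mulrN mulrA.
apply: (expected_payoff_ge r0 hPX hPY (a := a)) => //.
- by move=> i; exact: law2_ge0.
- by move=> j; rewrite /a; apply: measurable_fun_ifT.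
have /andP[p0 p1] := p01; have p1' : 0 <= 1 - p by rewrite subr_ge0.
move=> j s s0; rewrite sum_law2 /a/=.
rewrite [X in _ + _ * X]mean_cst payoffE ?leey//.
set y := half_discount r s; have y01 := half_discount01 r0 s0 : 0 <= y <= 1.
have e0 : half_discount r +oo ^+ 2 = 0 by rewrite expr0n.
(* For [s = +oo] the second branch is taken, but then [y = 0] as well. *)
have yoo b b' : (if (s < +oo)%E then y ^+ 2 * b else half_discount r +oo ^+ 2 * b')
    = y ^+ 2 * b.
  rewrite e0 mul0r; case: ifP => //; rewrite /y ltey.
  by case: eqP => // -> _; rewrite e0 mul0r.
rewrite yoo; have bm b b' := bounded_measurable_payoffr r0 alpha c b b' s.
elim/ord2_case: j; rewrite /C /=.
- rewrite f00 h00 f10; rewrite -[leLHS]addr0; apply: lerD.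
    rewrite ler_wpM2l// /A -mean_rampV//; apply: le_mean => //.
      exact: bounded_measurable_rampV.
    move=> v _; rewrite payoffE ?stop_time_ge0//; case: ifPn => [sv|_].
      have := late_stop s0 (ltW sv); rewrite -/y.
      by have := rampV_ge0 v; lra.
    by rewrite tauE mulr1.
  by rewrite mulr_ge0// mulr_ge0 ?sqr_ge0.
- rewrite f01 h01 f11 lerNl opprD mulrN1 mulrN opprK addrC.
  apply: le_trans (ramp_balance alpha01 c0 p1' p0 y01 bal).
  rewrite lerD2l -mulrN ler_wpM2l// -mulN1r -meanZ//; apply: le_mean => //.
  + exact: bounded_measurableZ.
  + exact: bounded_measurable_stop.
  move=> v _; rewrite payoffE ?stop_time_ge0// -stop_time_le// [(_ <= s)%E]leNgt -/y.
  by case: ifP => _ /=; rewrite ?mulr1 ?mulN1r// tauE mulrN1 opprK.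
Qed.

End randomized.
End example_game.

(** * The value on the three regions *)

Theorem proposition5p1 (R : realType) (r : R) (hr : 0 < r)
    (f h : 'I_2 -> 'I_2 -> R)
    (hh : forall p q : R, 0 <= p <= 1 -> 0 <= q <= 1 ->
       bilinear_ext h (law2 p) (law2 q) = 3 * p + 2 * q - 4)
    (hf : forall p q : R, 0 <= p <= 1 -> 0 <= q <= 1 ->
       bilinear_ext f (law2 p) (law2 q) = 2 * p + 3 * q - 1)
    (p q : R) (hp : 0 <= p <= 1) (hq : 0 <= q <= 1)
    (PX PY : probability (path_space R 1) R)
    (hPX : markov_law (law2 p) 0 PX) (hPY : markov_law (law2 q) 0 PY) :
  [/\ (2^-1 <= p -> q <= 2^-1 -> is_game_value r f h PX PY 0),
      (1 - q <= p -> 2^-1 <= q ->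
         is_game_value r f h PX PY ((2 * q - 1) / q * (p + q - 1))) &
      (q <= 1 - p -> p <= 2^-1 ->
         is_game_value r f h PX PY ((1 - 2 * p) / (1 - p) * (p + q - 1)))].
Proof.
have hv (x y : R) : 0 <= x <= 1 -> 0 <= y <= 1 ->
    x * y * h ord0 ord0 + x * (1 - y) * h ord0 ord_max +
    ((1 - x) * y * h ord_max ord0 + (1 - x) * (1 - y) * h ord_max ord_max) =
    3 * x + 2 * y - 4.
  by move=> x01 y01; rewrite -hh// bilinear_ext_law2.
have fv (x y : R) : 0 <= x <= 1 -> 0 <= y <= 1 ->
    x * y * f ord0 ord0 + x * (1 - y) * f ord0 ord_max +
    ((1 - x) * y * f ord_max ord0 + (1 - x) * (1 - y) * f ord_max ord_max) =
    2 * x + 3 * y - 1.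
  by move=> x01 y01; rewrite -hf// bilinear_ext_law2.
have z01 : 0 <= (0 : R) <= 1 by rewrite lexx ler01.
have o01 : 0 <= (1 : R) <= 1 by rewrite lexx ler01.
(* The four corners of the square recover the payoff matrices. *)
have h00 : h ord0 ord0 = 1 by have := hv 1 1 o01 o01; lra.
have h01 : h ord0 ord_max = -1 by have := hv 1 0 o01 z01; lra.
have h10 : h ord_max ord0 = -2 by have := hv 0 1 z01 o01; lra.
have h11 : h ord_max ord_max = -4 by have := hv 0 0 z01 z01; lra.
have f00 : f ord0 ord0 = 4 by have := fv 1 1 o01 o01; lra.
have f01 : f ord0 ord_max = 1 by have := fv 1 0 o01 z01; lra.
have f10 : f ord_max ord0 = 2 by have := fv 0 1 z01 o01; lra.
have f11 : f ord_max ord_max = -1 by have := fv 0 0 z01 z01; lra.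
have /andP[p0 p1] := hp; have /andP[q0 q1] := hq.
have never : 2^-1 <= p -> q <= 2^-1 -> is_game_value r f h PX PY 0.
  by move=> p2 q2; apply: game_value;
    [exact: (minimizer_never f hr hp hq h00 h01 h10 h11 hPX hPY p2 q2)|
     exact: (maximizer_never h hr hp hq f00 f01 f10 f11 hPX hPY p2 q2)].
have minimizer alpha c V : 0 <= alpha <= 1 -> 0 <= c ->
    alpha = 1 \/ (1 - q) * (1 + c * (1 - alpha)) = c * q ->
    V = p * (q - (1 - q) + 2 * (1 - q) * alpha) -
      (1 - p) * (1 - q) * (alpha + (1 - alpha) / (1 + c * (1 - alpha))) ->
    exists2 nu, mixed_stopping_time (@Y R 1 1) nu &
      forall mu, mixed_stopping_time (@X R 1 1) mu ->
      (expected_payoff r f h PX PY mu nu <= V%:E)%E.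
  by move=> a01 c0 bal ->; exact: (minimizer_randomized hr hp hq
    h00 h01 h10 h11 f01 f11 hPX hPY a01 c0 bal).
have maximizer alpha c V : 0 <= alpha <= 1 -> 0 <= c ->
    alpha = 1 \/ p * (1 + c * (1 - alpha)) = c * (1 - p) ->
    V = q * p * (alpha + (1 - alpha) / (1 + c * (1 - alpha))) -
      (1 - q) * (1 - p - p + 2 * p * alpha) ->
    exists2 mu, mixed_stopping_time (@X R 1 1) mu &
      forall nu, mixed_stopping_time (@Y R 1 1) nu ->
      (V%:E <= expected_payoff r f h PX PY mu nu)%E.
  by move=> a01 c0 bal ->; exact: (maximizer_randomized hr hp hq
    h00 h01 f00 f01 f10 f11 hPX hPY a01 c0 bal).
clear hh hf hv fv h00 h01 h10 h11 f00 f01 f10 f11.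
split => //.
(* On q = 1/2 the value is 0 and never stopping is optimal; this case is split off because [c] has
   the denominator 2q - 1. *)
- move=> pq; rewrite le_eqVlt => /predU1P[qE|q2].
    have -> : (2 * q - 1) / q * (p + q - 1) = 0 by rewrite -qE; field.
    by apply: never; rewrite -?qE//; lra.
  have qn0 : q != 0 by apply/eqP; lra.
  have q2n0 : 2 * q - 1 != 0 by apply/eqP; lra.
  apply: game_value.
    (* The minimizer has no atom at 0; the balance (1 - q)(1 + c) = c q determines [c]. *)
    have cE : 1 + (1 - q) / (2 * q - 1) * (1 - 0) = q / (2 * q - 1) by field.
    apply: (minimizer 0 ((1 - q) / (2 * q - 1))); rewrite ?cE ?lexx ?ler01//.
    + by apply: divr_ge0; lra.
    + by right; field.
    + by field; rewrite ?qn0 ?q2n0.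
  (* At p = 0 the stopping type is absent and any balanced parameters do; at p = 1 it is certain and
     stops at once. *)
  have [pE|pn0] := eqVneq p 0.
    have qE : q = 1 by lra.
    apply: (maximizer 0 0); rewrite ?lexx ?ler01//.
      by right; rewrite pE !mul0r.
    by rewrite pE qE; field.
  have [pE|pn1] := eqVneq p 1.
    apply: (maximizer 1 0); rewrite ?lexx ?ler01//; first by left.
    by rewrite pE; field.
  have np0 : 1 - p != 0 by apply: contra pn1; rewrite subr_eq0 eq_sym.
  (* The atom [a] solves p(1 - a) / (1 - a p) = 1 - q: if X has not stopped at time 0, the belief is
     on the line p + q = 1. The balance condition then gives [c]. *)
  pose a := (p + q - 1) / (p * q).
  have pq0 : 0 < p * q by rewrite mulr_gt0// lt_neqAle eq_sym ?pn0 ?qn0.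
  pose c := p * q / ((1 - p) * (2 * q - 1)).
  (* Both players reach the same maximal [ramp], so their randomized times have the same last
     date. *)
  have ca : 1 + c * (1 - a) = q / (2 * q - 1).
    by rewrite /a /c; field; rewrite ?np0 ?q2n0 ?pn0 ?qn0.
  apply: (maximizer a c); rewrite ?ca.
  + rewrite /a divr_ge0 ?(ltW pq0)//=; last by lra.
    by rewrite ler_pdivrMr//; nra.
  + by rewrite /c divr_ge0 ?(ltW pq0)// mulr_ge0//; lra.
  + by right; rewrite /c; field; rewrite ?np0 ?q2n0.
  + by rewrite /a; field; rewrite ?qn0 ?pn0 ?q2n0.
(* Mirror case: replacing (p, q) by (1 - q, 1 - p) exchanges the players' roles and reverses the
   sign of the value. The maximizer now has no atom. *)
- move=> pq; rewrite le_eqVlt => /predU1P[pE|p2].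
    have -> : (1 - 2 * p) / (1 - p) * (p + q - 1) = 0.
      by rewrite (_ : 1 - 2 * p = 0) ?mul0r// pE; field.
    by apply: never; rewrite ?pE//; lra.
  have pn1 : 1 - p != 0 by apply/eqP; lra.
  have p2n0 : 1 - 2 * p != 0 by apply/eqP; lra.
  apply: game_value; last first.
    have cE : 1 + p / (1 - 2 * p) * (1 - 0) = (1 - p) / (1 - 2 * p) by field.
    apply: (maximizer 0 (p / (1 - 2 * p))); rewrite ?cE ?lexx ?ler01//.
    + by apply: divr_ge0; lra.
    + by right; field.
    + by field; rewrite ?pn1 ?p2n0.
  have [qE|qn0] := eqVneq q 0.
    apply: (minimizer 1 0); rewrite ?lexx ?ler01//; first by left.
    by rewrite qE; field.
  have [qE|qn1] := eqVneq q 1.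
    have pE : p = 0 by lra.
    apply: (minimizer 0 0); rewrite ?lexx ?ler01//.
      by right; rewrite qE subrr !mul0r.
    by rewrite pE qE; field.
  have nq0 : 1 - q != 0 by apply: contra qn1; rewrite subr_eq0 eq_sym.
  (* This atom of the type Y = 1 moves the belief that Y = 0 from q up to 1 - p. *)
  pose a := (1 - p - q) / ((1 - p) * (1 - q)).
  have pq0 : 0 < (1 - p) * (1 - q).
    by rewrite mulr_gt0// lt_neqAle eq_sym ?pn1 ?nq0 subr_ge0.
  pose c := (1 - q) * (1 - p) / (q * (1 - 2 * p)).
  have ca : 1 + c * (1 - a) = (1 - p) / (1 - 2 * p).
    by rewrite /a /c; field; rewrite ?nq0 ?p2n0 ?pn1 ?qn0.
  apply: (minimizer a c); rewrite ?ca.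
  + rewrite /a divr_ge0 ?(ltW pq0)//=; last by lra.
    by rewrite ler_pdivrMr//; nra.
  + by rewrite /c divr_ge0 ?mulr_ge0//; lra.
  + by right; rewrite /c; field; rewrite ?qn0 ?p2n0.
  + by rewrite /a; field; rewrite ?nq0 ?pn1 ?p2n0.
Qed.
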